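(* Let $G$ be a Banach--Lie group with Lie algebra $\mathfrak{g}$ and neutral element $e$, let $M$ be a smooth Banach manifold, and let $\Phi : G\times M\to M$, $(g,x)\mapsto g\cdot x$, be a smooth action of $G$ on $M$. If the action is proper, then for every $x\in M$ the image of the bounded linear map $$\Psi_x = T_e\Phi^x : \mathfrak{g}\to T_xM,\qquad \xi\mapsto \xi_M(x),$$ is a closed subspace of $T_xM$.
   Context: For $x\in M$, the orbit map is $\Phi^x : G\to M$, $g\mapsto g\cdot x$, and $T_e\Phi^x$ is its tangent map at $e$, where $\mathfrak{g}$ is identified with $T_eG$. For $g\in G$, $\Phi_g : M\to M$ denotes the diffeomorphism $x\mapsto g\cdot x$. For $\xi\in\mathfrak{g}$, the associated vector field $\xi_M$ on $M$ is defined by $\xi_M(x)=\left.\frac{d}{dt}\right|_{t=0}\Phi_{\exp(t\xi)}(x)$. The action is called proper if the map $\Theta : G\times M\to M\times M$, $(g,x)\mapsto (g\cdot x,x)$, is proper, i.e., a closed map with compact fibers (fibers being the preimages of single points of $M\times M$). Neither $G$ nor $M$ is assumed to be finite-dimensional. *)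

(* Defs.v *)
From HB Require Import structures.
From mathcomp Require Import all_boot all_order all_algebra.
From mathcomp Require Import all_classical all_reals all_analysis.

Set Implicit Arguments.
Unset Strict Implicit.
Unset Printing Implicit Defensive.

Import Order.TTheory GRing.Theory Num.Theory.
Import numFieldNormedType.Exports.

Local Open Scope classical_set_scope.
Local Open Scope ring_scope.

HB.instance Definition _ (E F : puniformType) := Pointed.on (E * F)%type.

Section ProdComplete.
Context {E F : completeType}.

Lemma prod_cauchy_cvg (H : set_system (E * F)%type) :
  ProperFilter H -> cauchy H -> cvg H.
Proof.
move=> PH cH.
have c1 : cvg (fst @ H).
  apply: cauchy_cvg => A /= entA.
  have [|[B1 B2] /= [H1 H2] BB] := cH [set pq | A (pq.1.1, pq.2.1)].
    exists (A, setT); first by split => //; exact: filterT.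
    by move=> [[a b] [c d]] /= [Aac _]; exists ((a, c), (b, d)).
  exists (fst @` B1, fst @` B2) => /=.
    by split; [apply: filterS H1 | apply: filterS H2] => x Bx; exists x.
  by move=> [_ _] /= [[x Bx <-] [y By <-]]; exact: (BB (x, y)).
have c2 : cvg (snd @ H).
  apply: cauchy_cvg => A /= entA.
  have [|[B1 B2] /= [H1 H2] BB] := cH [set pq | A (pq.1.2, pq.2.2)].
    exists (setT, A); first by split => //; exact: filterT.
    by move=> [[a b] [c d]] /= [_ Abd]; exists ((a, c), (b, d)).
  exists (snd @` B1, snd @` B2) => /=.
    by split; [apply: filterS H1 | apply: filterS H2] => x Bx; exists x.
  by move=> [_ _] /= [[x Bx <-] [y By <-]]; exact: (BB (x, y)).
have h := cvg_pair c1 c2.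
apply/cvg_ex; exists (lim (fst @ H), lim (snd @ H)).
move=> A /h; rewrite /nbhs /=.
by apply: filterS => -[].
Qed.

HB.instance Definition _ :=
  Uniform_isComplete.Build (E * F)%type prod_cauchy_cvg.

End ProdComplete.

HB.instance Definition _ (R : realType) (E F : completeNormedModType R) :=
  Complete.on (E * F)%type.

Section Smooth.
Context {R : realType}.

(* For n > 0 the map is Frechet differentiable on the open set U and its       *)
(* differential, seen as the map (x, v) |-> Df(x)v on U x E, is of class n-1.  *)
(* At a fixed finite order this is slightly weaker than continuity of          *)
(* D^n f for the operator norm, but C_n.+1 here implies C^n for the operator   *)
(* norm, so that the two notions of C^oo coincide.                             *)
Fixpoint Cn_on (n : nat) : forall E F : normedModType R,
    set E -> (E -> F) -> Prop :=
  match n with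
  | 0 => fun E F U f => forall x, U x -> {for x, continuous f}
  | n'.+1 => fun E F U f =>
      (forall x, U x -> differentiable f x) /\
      @Cn_on n' (E * E)%type F (U `*` setT) (fun p => 'd f (fst p) (snd p))
  end.

Definition smooth_on (E F : normedModType R) (U : set E) (f : E -> F) : Prop :=
  forall n, Cn_on n U f.

End Smooth.

Section Manifold.
Context {R : realType}.

(* The chart [cmap] and its inverse [cinv] are total functions; only their     *)
(* values on [cdom] and on the image of [cdom] matter. Each chart has its own  *)
(* Banach space.                                                               *)
Record chart (X : Type) := Chart {
  cmodel : completeNormedModType R;
  cdom : set X;
  cmap : X -> cmodel;
  cinv : cmodel -> X
}.

Arguments cdom {X} c.
Arguments cmap {X} c.
Arguments cinv {X} c.

Definition cimage X (c : chart X) : set (cmodel c) := cmap c @` cdom c.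
Arguments cimage {X} c.

Record is_chart (X : topologicalType) (c : chart X) : Prop := IsChart {
  cdom_open : open (cdom c);
  cimage_open : open (cimage c);
  cmap_continuous : forall x, cdom c x -> {for x, continuous (cmap c)};
  cinv_continuous : forall u, cimage c u -> {for u, continuous (cinv c)};
  cmapK : forall x, cdom c x -> cinv c (cmap c x) = x
}.

Definition smooth_transition X (c d : chart X) : Prop :=
  smooth_on (cmap c @` (cdom c `&` cdom d)) (cmap d \o cinv c).

(* No separation axiom is imposed on the underlying topological space, so that *)
(* Hausdorff Banach manifolds are a particular case.                           *)
Record banach_manifold := BanachManifold {
  carrier :> topologicalType;
  chart_index : Type;
  atlas : chart_index -> chart carrier;
  index_at : carrier -> chart_index;
  atlas_chart : forall i, is_chart (atlas i);
  atlas_smooth : forall i j, smooth_transition (atlas i) (atlas j);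
  index_at_dom : forall x, cdom (atlas (index_at x)) x
}.
Arguments atlas : clear implicits.

Definition chart_at (M : banach_manifold) (x : M) : chart M :=
  atlas M (index_at x).

Definition prod_chart X Y (c : chart X) (d : chart Y) : chart (X * Y) :=
  {| cmodel := (cmodel c * cmodel d)%type;
     cdom := cdom c `*` cdom d;
     cmap := fun p => (cmap c p.1, cmap d p.2);
     cinv := fun u => (cinv c u.1, cinv d u.2) |}.

Definition prod_atlas X Y I J (A : I -> chart X) (B : J -> chart Y) :
    I * J -> chart (X * Y) :=
  fun k => prod_chart (A k.1) (B k.2).

Definition line_atlas : unit -> chart R :=
  fun=> {| cmodel := R^o; cdom := setT; cmap := id; cinv := id |}.

Definition smooth_map (X Y : topologicalType) I J (A : I -> chart X)
    (B : J -> chart Y) (f : X -> Y) : Prop :=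
  continuous f /\
  forall i j,
    smooth_on (cmap (A i) @` (cdom (A i) `&` f @^-1` cdom (B j)))
      (cmap (B j) \o f \o cinv (A i)).

(* Tangent vectors at x are represented by their coordinates in the chart      *)
(* [chart_at x]. Differentials of transition maps are toplinear isomorphisms,  *)
(* so this is the usual T_x M as a topological vector space.                   *)
Definition tangent_space (M : banach_manifold) (x : M) :
  completeNormedModType R := cmodel (chart_at x).

(* The tangent map T_x f : T_x M -> T_y N, meant for y = f x; taking y as an   *)
(* argument avoids transports when y is only provably equal to f x.            *)
Definition tangent_map (M N : banach_manifold) (f : M -> N) (x : M) (y : N) :
    {linear tangent_space x -> tangent_space y} :=
  'd (cmap (chart_at y) \o f \o cinv (chart_at x)) (cmap (chart_at x) x).

(* Velocity at time 0 of a curve c with c 0 = y.                               *)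
Definition velocity (M : banach_manifold) (c : R -> M) (y : M) :
    tangent_space y :=
  derive1 (cmap (chart_at y) \o c) 0.

End Manifold.

Arguments chart : clear implicits.
Arguments banach_manifold : clear implicits.
Arguments atlas {R} b.

Section LieGroup.
Variable R : realType.

Record banach_lie_group := BanachLieGroup {
  lie_manifold :> banach_manifold R;
  lie_one : lie_manifold;
  lie_mul : lie_manifold -> lie_manifold -> lie_manifold;
  lie_inv : lie_manifold -> lie_manifold;
  lie_mulA : associative lie_mul;
  lie_mul1 : left_id lie_one lie_mul;
  lie_mulV : left_inverse lie_one lie_inv lie_mul;
  lie_mul_smooth :
    smooth_map (prod_atlas (atlas lie_manifold) (atlas lie_manifold))
      (atlas lie_manifold) (fun p => lie_mul p.1 p.2);
  lie_inv_smooth :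
    smooth_map (atlas lie_manifold) (atlas lie_manifold) lie_inv
}.

Definition lie_algebra (G : banach_lie_group) : completeNormedModType R :=
  tangent_space (lie_one G).

Definition is_one_parameter_subgroup (G : banach_lie_group) (c : R -> G) :=
  smooth_map line_atlas (atlas G) c /\
  forall s t, c (s + t) = lie_mul (c s) (c t).

(* This property determines the exponential map of G uniquely.                 *)
Definition is_exponential_map (G : banach_lie_group)
    (expG : lie_algebra G -> G) : Prop :=
  forall xi : lie_algebra G,
    is_one_parameter_subgroup (fun t : R => expG (t *: xi)) /\
    velocity (fun t : R => expG (t *: xi)) (lie_one G) = xi.

Variables (G : banach_lie_group) (M : banach_manifold R).

Record is_smooth_action (Phi : G -> M -> M) : Prop := IsSmoothAction {
  action_one : forall x, Phi (lie_one G) x = x;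
  action_mul : forall g h x, Phi (lie_mul g h) x = Phi g (Phi h x);
  action_smooth : smooth_map (prod_atlas (atlas G) (atlas M)) (atlas M)
    (fun p : G * M => Phi p.1 p.2)
}.

Definition proper_map (X Y : topologicalType) (f : X -> Y) : Prop :=
  (forall A, closed A -> closed (f @` A)) /\
  (forall y, compact (f @^-1` [set y])).

Definition is_proper_action (Phi : G -> M -> M) : Prop :=
  proper_map (fun p : G * M => (Phi p.1 p.2, p.2)).

Definition orbit_map (Phi : G -> M -> M) (x : M) : G -> M := fun g => Phi g x.

(* T_e Phi^x; the target point is x since Phi e x = x.                         *)
Definition orbit_tangent (Phi : G -> M -> M) (x : M) :
    {linear lie_algebra G -> tangent_space x} :=
  tangent_map (orbit_map Phi x) (lie_one G) x.

Definition fundamental_field (expG : lie_algebra G -> G) (Phi : G -> M -> M)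
    (xi : lie_algebra G) (x : M) : tangent_space x :=
  velocity (fun t : R => Phi (expG (t *: xi)) x) x.

End LieGroup.

(* Main.v *)
Require Import Defs.
From mathcomp Require Import all_boot all_order all_algebra.
From mathcomp Require Import all_classical all_reals all_analysis.
From mathcomp Require Import ring lra.

(* Let A = T_e Phi^x. It is enough that unit vectors u_n with A u_n -> 0 always  *)
(* have a limit along every ultrafilter finer than n -> oo: then |A xi| controls *)
(* the distance from xi to ker A, and the range of A is closed.                  *)
(*                                                                               *)
(* No exponential map is needed. In the chart at e put h_n = tau / (n+1) u_n and *)
(* q_n = h_n^(n+1). Strict differentiability of the product shows that q_n lies  *)
(* within eta tau of tau u_n, with eta arbitrarily small when tau is. Each of    *)
(* the n+1 steps moves x by O(|A h_n|) + o(1/n), hence q_n x -> x. Properness    *)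
(* makes q_n converge along the ultrafilter, so the differences q_n^-1 q_m tend  *)
(* to e and |u_n - u_m| is eventually at most 3 eta: the u_n form a Cauchy       *)
(* filter.                                                                       *)

Set Implicit Arguments.
Unset Strict Implicit.
Unset Printing Implicit Defensive.

Import Order.TTheory GRing.Theory Num.Theory.
Import numFieldNormedType.Exports.
Local Open Scope classical_set_scope.
Local Open Scope ring_scope.

(** Write A for T_e Phi^x. By [closed_range_of_bounded_section], the range of A is closed once every
    A x has a preimage of norm at most C |A x|. By [bounded_section_of_compact], such a C can fail
    to exist only if there are unit vectors u_n, uniformly far from ker A, with A u_n -> 0.

    [orbit_tangent_compact] excludes this. Iterating small steps in the direction u_n gives group
    elements q_n that remember u_n ([lie_pow_chart]) and almost fix x ([lie_pow_action]). Properness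
    makes them converge along an ultrafilter ([orbit_return_cvg]), so u_n converges too, and its
    limit would lie in ker A. The local estimates come from strict differentiability in charts
    ([smooth_map_strict]). Separately, [velocity_orbit] identifies A with the fundamental field by
    the chain rule. *)

Arguments cdom {R X} c.
Arguments cmap {R X} c.
Arguments cinv {R X} c.
Arguments cimage {R X} c.

(** * Mean value inequality and strict differentiability *)

Section Calculus.
Context {R : realType}.

Lemma near_normP (E : normedModType R) (a : E) (P : set E) :
  (\forall x \near a, P x) ->
  exists2 d : R, 0 < d & forall x, `|x - a| < d -> P x.
Proof.
move=> /nbhs_normP[d d0 dP]; exists d => // x xa; apply: dP.
by rewrite /= distrC.
Qed.

Lemma differentiable_le (E F : normedModType R) (f : E -> F) (a : E) (e : R) :
  differentiable f a -> 0 < e ->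
  \forall x \near a, `|f x - f a - 'd f a (x - a)| <= e * `|x - a|.
Proof.
case=> -[_ df] e0; have := iffLR (eqaddoP _ _ _ _) df e e0; rewrite lim_id//.
move=> h; apply: filterS h => x; rewrite !fctE /= opprD addrA.
exact.
Qed.

(** Continuous induction: the supremum of the times up to which the bound with slope K + e is
    attained belongs to that set, and it cannot be less than 1, because the local estimate there
    carries the bound further. *)
Lemma increment_le (F : normedModType R) (phi : R -> F) (K : R) :
  (forall t e : R, 0 <= t <= 1 -> 0 < e ->
    \forall s \near t, `|phi s - phi t| <= (K + e) * `|s - t|) ->
  `|phi 1 - phi 0| <= K.
Proof.
move=> dphi; apply/ler_addgt0Pr => e e0.
pose S := [set t : R | 0 <= t <= 1 /\ `|phi t - phi 0| <= (K + e) * t].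
have S0 : S 0 by split; rewrite ?lexx ?ler01// subrr normr0 mulr0.
have Sub : ubound S 1 by move=> t [/andP[]].
have hS : has_sup S by split; [exists 0|exists 1].
pose c := sup S.
have c01 : 0 <= c <= 1.
  by rewrite ub_le_sup ?ge_sup//; [exists 0|exists 1].
have [d d0 dP] := near_normP (dphi c e c01 e0).
have Sc : `|phi c - phi 0| <= (K + e) * c.
  have [s Ss sc] := sup_adherent d0 hS.
  have sc' : s <= c by apply: ub_le_sup => //; exists 1.
  have := dP s; rewrite -/c in sc.
  rewrite ler0_norm ?subr_le0// opprB => /(_ ltac:(lra)) h.
  have [_ hs] := Ss; rewrite -[phi c](subrK (phi s)) -addrA.
  apply: le_trans (ler_normD _ _) _; rewrite distrC; lra.
have [c1|c1] := ltP c 1; last first.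
  have c1' : c = 1 by apply/eqP; rewrite eq_le c1; case/andP: c01 => _ ->.
  by move: Sc; rewrite c1' mulr1.
pose s := Num.min (c + d / 2) 1.
have [cs sd s1] : [/\ c < s, s < c + d & s <= 1].
  rewrite /s; split; first by rewrite lt_min c1 ltrDl divr_gt0.
    by rewrite gt_min; apply/orP; left; lra.
  by rewrite ge_min lexx orbT.
suff : S s by move=> /(ub_le_sup (ex_intro _ 1 Sub)); rewrite -/c; lra.
split; first by rewrite s1 andbT; lra.
have := dP s; rewrite ger0_norm; last lra.
move=> /(_ ltac:(lra)) h; rewrite -[phi s](subrK (phi c)) -addrA.
apply: le_trans (ler_normD _ _) _; lra.
Qed.

Lemma mean_value_le (E F : normedModType R) (f : E -> F) (x y : E) (c : F)
    (K : R) :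
  (forall t : R, 0 <= t <= 1 -> differentiable f (x + t *: (y - x)) /\
     `|'d f (x + t *: (y - x)) (y - x) - c| <= K) ->
  `|f y - f x - c| <= K.
Proof.
move=> df; pose v := y - x; pose phi t := f (x + t *: v) - t *: c.
have -> : f y - f x - c = phi 1 - phi 0.
  rewrite /phi !scale1r !scale0r addr0 subr0 /v subrKC.
  by rewrite -!addrA [- f x - c]addrC.
apply: increment_le => t e t01 e0; have [dft Kt] := df t t01.
(* Adding 1 to the denominator covers the case v = 0. *)
have e'0 : 0 < e / (`|v| + 1) by rewrite divr_gt0// ltr_wpDl.
have [d d0 dP] := near_normP (differentiable_le dft e'0).
have d'0 : 0 < d / (`|v| + 1) by rewrite divr_gt0// ltr_wpDl.
apply/nbhs_normP; exists (d / (`|v| + 1)) => //= s.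
rewrite /= distrC ltr_pdivlMr ?ltr_wpDl// => sd.
have sv : x + s *: v - (x + t *: v) = (s - t) *: v.
  by rewrite scalerBl opprD addrACA subrr add0r.
have := dP (x + s *: v); rewrite -/v sv normrZ.
have st0 := normr_ge0 (s - t); have v0 := normr_ge0 v.
move=> /(_ _)/wrap[]; first by nra.
rewrite linearZ /= => h.
have -> : phi s - phi t = (f (x + s *: v) - f (x + t *: v)
    - (s - t) *: 'd f (x + t *: v) v)
    + (s - t) *: ('d f (x + t *: v) v - c).
  rewrite /phi; move: (f _) (f _) ('d f _ v) => A B D.
  rewrite scalerBr addrA subrK [(s - t) *: c]scalerBl !opprB.
  by rewrite addrACA [RHS]addrACA [- (s *: c) + _]addrC.
apply: le_trans (ler_normD _ _) _; rewrite normrZ mulrDl addrC lerD//.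
  by rewrite mulrC ler_wpM2r.
apply: le_trans h _.
have ev : e / (`|v| + 1) * `|v| <= e.
  by rewrite -mulrA ger_pMr// mulrC ler_pdivrMr; lra.
nra.
Qed.


(* Differentiability of (x, v) |-> Df(x)v at the single point (a, 0) gives an   *)
(* error e max(|x - a|, |v|); taking |v| = d / 2 for all x in a ball of radius  *)
(* d / 2 turns it, by homogeneity, into an operator norm estimate.              *)
Lemma diff_near_le (E F : normedModType R) (f : E -> F) (a : E) (e : R) :
  differentiable (fun p : E * E => 'd f (fst p) (snd p)) (a, 0 : E) -> 0 < e ->
  \forall x \near a, forall v, `|'d f x v - 'd f a v| <= e * `|v|.
Proof.
move=> dg e0; have e30 : 0 < e / 3 by rewrite divr_gt0.
have [d d0] := near_normP (differentiable_le dg e30).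
set D := 'd _ (a, 0) => dP.
apply/nbhs_normP; exists (d / 2) => /=; first by rewrite divr_gt0.
move=> x; rewrite /= distrC => xa v.
have [->|v0] := eqVneq v 0; first by rewrite !linear0 addr0 !normr0 mulr0.
have nv : 0 < `|v| by rewrite normr_gt0.
pose k := d / 2 / `|v|; pose w := k *: v.
have k0 : 0 < k by rewrite !divr_gt0.
have nw : `|w| = d / 2 by rewrite normrZ gtr0_norm// divfK ?gt_eqF.
have bd u z : `|u - a| < d / 2 -> `|z| <= d / 2 ->
    `|'d f u z - D (u - a, z)| <= e / 3 * (d / 2).
  move=> ua zd; have := dP (u, z).
  have -> : (u, z) - (a, 0) = (u - a, z - 0) by [].
  rewrite subr0.
  rewrite prod_normE /= linear0 subr0 => /(_ _)/wrap[].
    by rewrite gt_max; apply/andP; split; lra.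
  move=> /le_trans; apply; rewrite ler_wpM2l ?(ltW e30)//.
  by rewrite ge_max (ltW ua).
have h1 := bd x w xa; have h2 := bd a w; have h3 := bd x 0 xa.
move: h1 h2 h3; rewrite nw subrr !normr0 !linear0 sub0r normrN.
move=> /(_ (lexx _)) h1 /(_ ltac:(lra) (lexx _)) h2 /(_ ltac:(lra)) h3.
have Dw : D (x - a, w) = D (x - a, 0) + D (0, w).
  by rewrite -linearD; congr (D (_, _)); rewrite /= ?addr0 ?add0r.
suff : `|'d f x w - 'd f a w| <= e * (d / 2).
  rewrite /w !linearZ /= -scalerDr normrZ gtr0_norm// -nw normrZ gtr0_norm//.
  by rewrite mulrCA ler_pM2l.
have -> : 'd f x w - 'd f a w = ('d f x w - D (x - a, w))
    - ('d f a w - D (0, w)) + D (x - a, 0).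
  rewrite Dw; move: (D _) (D _) ('d f x w) ('d f a w) => A B X Y.
  by rewrite [- (B + A)]opprD opprB !addrA subrK [RHS]addrAC subrK.
apply: le_trans (ler_normD _ _) _.
apply: le_trans (lerD (ler_normB _ _) (lexx _)) _.
lra.
Qed.

(** Mean value inequality on the segment from x to y, which stays in the ball by convexity; there
    the differential is within e of the one at a. *)
Lemma strict_diff_le (E F : normedModType R) (f : E -> F) (a : E) (e : R) :
  (\forall x \near a, differentiable f x) ->
  differentiable (fun p : E * E => 'd f (fst p) (snd p)) (a, 0 : E) -> 0 < e ->
  exists2 d : R, 0 < d & forall x y, `|x - a| < d -> `|y - a| < d ->
    `|f y - f x - 'd f a (y - x)| <= e * `|y - x|.
Proof.
move=> df dg e0; have [d d0 dP] := near_normP (filterI df (diff_near_le dg e0)).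
exists d => // x y xa ya; apply: mean_value_le => t /andP[t0 t1].
suff /dP[h /(_ (y - x))//] : `|x + t *: (y - x) - a| < d.
have -> : x + t *: (y - x) - a = (1 - t) *: (x - a) + t *: (y - a).
  rewrite scalerBl scale1r [RHS]addrAC -[RHS]addrA -scalerBr opprB.
  by rewrite [y - a + _]addrA subrK addrAC.
apply: le_lt_trans (ler_normD _ _) _; rewrite !normrZ !ger0_norm ?subr_ge0//.
have [->|t1'] := eqVneq t 1; first lra.
have : t < 1 by rewrite lt_neqAle t1' t1.
nra.
Qed.

Lemma strict_differentiable (E F : normedModType R) (U : set E) (f : E -> F)
    (a : E) (e : R) :
  nbhs a U -> smooth_on U f -> 0 < e ->
  exists2 d : R, 0 < d & forall x y, `|x - a| < d -> `|y - a| < d ->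
    `|f y - f x - 'd f a (y - x)| <= e * `|y - x|.
Proof.
move=> Ua /(_ 2)[df [dg _]] e0; apply: strict_diff_le => //.
  by apply: filterS Ua.
by apply: dg; split => //=; exact: nbhs_singleton.
Qed.

End Calculus.

(** * Proper maps and ultrafilters *)

(** For A in F, the closed set f(closure A) contains the limit y, so closure A meets the fibre over
    y. These traces generate a proper filter on a compact fibre, hence have a cluster point. *)
Lemma proper_cluster (X Y : topologicalType) (f : X -> Y) (F : set_system X)
    (y : Y) :
  proper_map f -> ProperFilter F -> f @ F --> y ->
  exists2 x, f x = y & cluster F x.
Proof.
move=> [fclosed fcompact] PF fy.
pose B (A : set X) := closure A `&` f @^-1` [set y].
have BF : ProperFilter (filter_from F B).
  apply: filter_from_proper.
    apply: filter_from_filter; first by exists setT; exact: filterT.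
    move=> A1 A2 FA1 FA2; exists (A1 `&` A2); first exact: filterI.
    by move=> x [clx fx]; split; split=> //; apply: closure_subset clx.
  move=> A FA; have : closed (f @` closure A).
    by apply: fclosed; exact: closed_closure.
  move=> /(_ y)[|x clx fxy]; last by exists x.
  move=> V /fy FV.
  have [x [Ax Vx]] := filter_ex (filterI FA (FV : F (f @^-1` V))).
  by exists (f x); split => //; exists x => //; exact: subset_closure.
have [|x [fx clx]] := fcompact y _ BF.
  by exists setT; [exact: filterT|move=> x []].
exists x => //; rewrite clusterE => A FA; apply: closed_closure.
move: clx; rewrite clusterE => /(_ (B A)) clB.
apply: (@closure_subset _ (B A) (closure A)); first by move=> z [].
by apply: clB; exists A.
Qed.

(** A cluster point of an ultrafilter is a limit, so no subsequence and no countability assumption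
    is involved. *)
Lemma proper_ultra_cvg (T : Type) (X Y : topologicalType) (f : X -> Y)
    (U : set_system T) (q : T -> X) (y : Y) :
  proper_map f -> UltraFilter U -> f \o q @ U --> y ->
  exists2 x, f x = y & q @ U --> x.
Proof.
move=> fP UU fqy; have [x fx clx] := @proper_cluster _ _ f (q @ U) y fP _ fqy.
exists x => // V xV.
have [//|UnV] := in_ultra_setVsetC (q @^-1` V) UU.
by have [z []] := clx (~` V) V UnV xV.
Qed.

Lemma open_setX (X Y : topologicalType) (A : set X) (B : set Y) :
  open A -> open B -> open (A `*` B).
Proof.
rewrite !openE => oA oB [x y] [/= Ax Bx].
by exists (A, B) => //; split; [exact: oA|exact: oB].
Qed.

Lemma continuous_prod_map (X Y X' Y' : topologicalType) (f : X -> X')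
    (g : Y -> Y') (p : X * Y) :
  {for p.1, continuous f} -> {for p.2, continuous g} ->
  {for p, continuous (fun q => (f q.1, g q.2))}.
Proof.
move=> fp gp; apply: cvg_pair.
  by move: fp; apply: cvg_comp; exact: cvg_fst.
by move: gp; apply: cvg_comp; exact: cvg_snd.
Qed.

(** * Product charts and local representatives *)

Section Charts.
Context {R : realType}.

Lemma prod_is_chart (X Y : topologicalType) (c : chart R X) (d : chart R Y) :
  is_chart c -> is_chart d -> is_chart (prod_chart c d).
Proof.
move=> hc hd; split.
- by apply: open_setX; exact: cdom_open.
- rewrite /cimage; have -> : cmap (prod_chart c d) @` cdom (prod_chart c d) =
      (cmap c @` cdom c) `*` (cmap d @` cdom d).
    apply/seteqP; split => [_ [[x y] [/= cx dy] <-]|].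
      by split => /=; [exists x|exists y].
    by move=> [_ _] [/= [x cx <-] [y dy <-]]; exists (x, y).
  by apply: open_setX; exact: cimage_open.
- move=> [x y] [cx dy]; apply: continuous_prod_map.
    exact: (cmap_continuous hc).
  exact: (cmap_continuous hd).
- move=> _ [[x y] [/= cx dy] <-]; apply: continuous_prod_map.
    by apply: (cinv_continuous hc); exists x.
  by apply: (cinv_continuous hd); exists y.
- by move=> [x y] [/= cx dy]; rewrite /= !cmapK.
Qed.

Lemma local_rep_nbhs (X Y : topologicalType) (c : chart R X) (d : chart R Y)
    (f : X -> Y) (x : X) :
  is_chart c -> is_chart d -> {for x, continuous f} -> cdom c x ->
  cdom d (f x) ->
  \forall u \near cmap c x,
    (cmap c @` (cdom c `&` f @^-1` cdom d)) u.
Proof.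
move=> hc hd fx cx dfx.
have cxi : (cmap c @` cdom c) (cmap c x) by exists x.
have ci := cinv_continuous hc cxi.
have dn : \forall z \near x, cdom d (f z).
  by apply: fx; apply: open_nbhs_nbhs; split => //; exact: cdom_open.
have := ci; rewrite /prop_for /continuous_at (cmapK hc)// => /(_ _ dn) /= dn'.
have im : \forall u \near cmap c x, (cmap c @` cdom c) u.
  by apply: open_nbhs_nbhs; split => //; exact: cimage_open.
have dn2 : \forall u \near cmap c x, cdom d (f (cinv c u)) := dn'.
near=> u; have [z cz zu] : (cmap c @` cdom c) u by near: u; exact: im.
have du : cdom d (f (cinv c u)) by near: u; exact: dn2.
by exists z => //; split => //; rewrite /= -(cmapK hc cz) zu.
Unshelve. all: by end_near. Qed.

End Charts.

(** * Group identities from the left-sided axioms *)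

Section Group.
Context {R : realType} (G : banach_lie_group R).
Local Notation "x ** y" := (@lie_mul R G x y) (at level 40).
Local Notation e := (lie_one G).

Lemma lie_mulI (g h k : G) : g ** h = g ** k -> h = k.
Proof.
move=> /(congr1 (fun z => lie_inv g ** z)).
by rewrite !lie_mulA lie_mulV !lie_mul1.
Qed.

Lemma lie_mulr1 (g : G) : g ** e = g.
Proof.
by apply: (@lie_mulI (lie_inv g)); rewrite lie_mulA lie_mulV lie_mul1.
Qed.

Lemma lie_mulrV (g : G) : g ** lie_inv g = e.
Proof.
by apply: (@lie_mulI (lie_inv g)); rewrite lie_mulA lie_mulV lie_mul1 lie_mulr1.
Qed.

Lemma lie_mulKr (g h : G) : g ** (lie_inv g ** h) = h.
Proof. by rewrite lie_mulA lie_mulrV lie_mul1. Qed.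

End Group.

(** * Closed range criteria for bounded linear maps *)

Section ClosedRange.
Context {R : realType}.

(** Approximate y by A x_n with error 2^-n and lift the increments with norm control: the lifts are
    summable, and x_0 plus their sum is a preimage of y. *)
Lemma closed_range_of_bounded_section (E : completeNormedModType R)
    (F : normedModType R) (A : {linear E -> F}) (C : R) :
  continuous A -> (forall x, exists2 z, A z = A x & `|z| <= C * `|A x|) ->
  closed (range A).
Proof.
move=> cA AC y cly.
have r0 n : 0 < (2^-1 : R) ^+ n by rewrite exprn_gt0// invr_gt0.
have ex n : exists x, `|A x - y| <= 2^-1 ^+ n.
  have [_ [[x _ <-]]] := cly _ (nbhsx_ballx y _ (r0 n)).
  by rewrite -ball_normE /= distrC => /ltW; exists x.
have [x xP] := choice ex.
have ez n : exists zn, A zn = A (x n.+1 - x n) /\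
    `|zn| <= C * `|A (x n.+1 - x n)|.
  by have [zn ? ?] := AC (x n.+1 - x n); exists zn.
have [z zP] := choice ez.
have C0 : 0 <= `|C| by [].
(* Two consecutive errors add up to at most 2 * 2^-n; the absolute value is there because C has no
   given sign. *)
have zle n : `|z n| <= geometric (2 * `|C|) 2^-1 n.
  have [_ /le_trans] := zP n; apply.
  rewrite /geometric /= -mulrA mulrCA.
  apply: le_trans (ler_norm _) _; rewrite normrM normr_id ler_wpM2l//.
  rewrite linearB /= -(subrKA y) (le_trans (ler_normD _ _))//.
  have := xP n; have := xP n.+1; rewrite exprS [`|y - _|]distrC.
  have := r0 n; lra.
have cz : cvgn (series z).
  apply: normed_cvg; apply: series_le_cvg zle _ => //.
    by move=> n; rewrite /geometric /= mulr_ge0 ?mulr_ge0 ?(ltW (r0 n)).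
  by apply: is_cvg_geometric_series; rewrite ger0_norm; lra.
have Az n : A (x 0%N + series z n) = A (x n).
  elim: n => [|n IH]; first by rewrite /series /= big_geq// addr0.
  rewrite seriesSr addrA linearD IH (zP n).1 linearB /= addrC subrK//.
exists (x 0%N + limn (series z)) => //.
have l1 : A (x n) @[n --> \oo] --> A (x 0%N + limn (series z)).
  under eq_fun do rewrite -Az.
  apply: (@cvg_comp _ _ _ (fun n => x 0%N + series z n) A); last exact: cA.
  by apply: cvgD => //; exact: cvg_cst.
have l2 : A (x n) @[n --> \oo] --> y.
  apply/cvgrPdist_le => e e0.
  have : geometric 1 (2^-1 : R) @ \oo --> 0.
    by apply: cvg_geometric; rewrite ger0_norm; lra.
  move=> /cvgrPdist_le/(_ e e0); apply: filterS => n.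
  rewrite /geometric /= mul1r sub0r normrN ger0_norm ?(ltW (r0 n))//.
  by apply: le_trans; rewrite distrC.
exact: (cvg_unique _ l1 l2).
Qed.

(** If no C works, normalised almost-shortest elements of bad fibres of A are unit vectors at
    distance at least 1/2 from ker A with A u_n -> 0. Their limit along an ultrafilter lies in ker
    A, a contradiction. *)
Lemma bounded_section_of_compact (E F : normedModType R) (A : {linear E -> F}) :
  continuous A ->
  (forall (u : nat -> E) (U : set_system nat), UltraFilter U ->
     \oo `<=` U -> (forall n, `|u n| = 1) -> A \o u @ \oo --> (0 : F) ->
     cvg (u @ U)) ->
  exists C : R, forall x, exists2 z, A z = A x & `|z| <= C * `|A x|.
Proof.
move=> cA Acompact; apply: contrapT => noC.
have ex n : exists u : E, [/\ `|u| = 1, `|A u| <= n.+1%:R^-1 &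
    forall k, A k = 0 -> 1 <= 2 * `|u - k|].
  have [x xP] : exists x : E, forall z, A z = A x -> n.+1%:R * `|A x| < `|z|.
    apply: contrapT => h; apply: noC; exists n.+1%:R => x.
    apply: contrapT => h'; apply: h; exists x => z Azx.
    by rewrite ltNge; apply/negP => zx; apply: h'; exists z.
  have Ax0 : 0 < `|A x|.
    rewrite normr_gt0; apply/eqP => Ax0.
    have := xP 0; rewrite Ax0 linear0 !normr0 mulr0 => /(_ erefl).
    by rewrite ltxx.
  pose S := [set `|z| | z in [set z | A z = A x]].
  have Sn : S !=set0 by exists `|x|; exists x.
  pose b : R := n.+1%:R * `|A x|.
  have b0 : 0 < b by rewrite mulr_gt0.
  have lbS : lbound S b by move=> _ [z Az <-]; exact/ltW/xP.
  have iS : has_inf S by split => //; exists b.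
  have bi : b <= inf S by exact: lb_le_inf.
  have i0 : 0 < inf S by exact: lt_le_trans bi.
  (* The infimum itself serves as the margin, so |z| is less than twice the least norm in its
     fibre. *)
  have [_ [z Az <-] zi] := inf_adherent i0 iS.
  have zb := xP z Az.
  have nz : 0 < `|z| by exact: lt_trans zb.
  exists (`|z|^-1 *: z); split.
  - by rewrite normrZ normfV normr_id mulVf// gt_eqF.
  - rewrite linearZ normrZ normfV normr_id Az ler_pdivrMl//.
    by rewrite mulrC ler_pdivlMl//; exact: ltW.
  - move=> k Ak.
    have -> : `|z|^-1 *: z - k = `|z|^-1 *: (z - `|z| *: k).
      by rewrite scalerBr scalerA mulVf ?gt_eqF// scale1r.
    rewrite normrZ normfV normr_id mulrCA ler_pdivlMl// mulr1.
    have : inf S <= `|z - `|z| *: k|.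
      apply: ge_inf; first by exists b.
      by exists (z - `|z| *: k) => //=; rewrite linearB linearZ /= Ak scaler0 subr0.
    lra.
have [u uP] := choice ex.
have [U [UU oU]] := ultraFilterLemma (_ : ProperFilter \oo).
have Au0 : A \o u @ \oo --> (0 : F).
  apply/cvgrPdist_le => e e0.
  have := @cvg_harmonic R => /cvgrPdist_le/(_ e e0); apply: filterS => n.
  rewrite /= !sub0r !normrN [`|_^-1|]ger0_norm ?invr_ge0//.
  by apply: le_trans; have [] := uP n.
have /cvg_ex[l ul] := Acompact u U UU oU (fun n => let: And3 h _ _ := uP n in h) Au0.
have Al : A l = 0.
  have h1 : A \o u @ U --> A l by apply: cvg_comp ul _; exact: cA.
  have h2 : A \o u @ U --> (0 : F).
    by apply: cvg_trans Au0 => P; exact: oU.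
  exact: (cvg_unique _ h1 h2).
have [|n] := @filter_ex _ U _ [set n | `|l - u n| < 2^-1].
  by move: ul => /cvgrPdist_lt; apply; rewrite invr_gt0.
have [_ _ /(_ l Al)] := uP n; rewrite /= distrC; lra.
Qed.

End ClosedRange.

(** * Coordinate balls and strict differentiability on manifolds *)

Section ChartBall.
Context {R : realType}.

(** Membership in the domain is required because [cmap] is a total function with arbitrary values
    outside it. *)
Definition chart_ball (X : banach_manifold R) (x : X) (d : R) : set X :=
  [set g | cdom (chart_at x) g /\
           `|cmap (chart_at x) g - cmap (chart_at x) x| < d].

Lemma chart_at_is_chart (X : banach_manifold R) (x : X) :
  is_chart (chart_at x).
Proof. exact: atlas_chart. Qed.

Lemma chart_at_dom (X : banach_manifold R) (x : X) : cdom (chart_at x) x.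
Proof. exact: index_at_dom. Qed.

Lemma chart_ballxx (X : banach_manifold R) (x : X) (d : R) :
  0 < d -> chart_ball x d x.
Proof. by move=> d0; split; [exact: chart_at_dom|rewrite subrr normr0]. Qed.

Lemma chart_ball_sub (X : banach_manifold R) (w : X) (r r' : R) :
  r' <= r -> chart_ball w r' `<=` chart_ball w r.
Proof. by move=> rr v [dv vr]; split => //; exact: lt_le_trans rr. Qed.

Lemma nbhs_chart_ball (X : banach_manifold R) (x : X) (d : R) :
  0 < d -> nbhs x (chart_ball x d).
Proof.
move=> d0; apply: filterI.
  apply: open_nbhs_nbhs; split; last exact: chart_at_dom.
  exact: cdom_open (chart_at_is_chart x).
have := cmap_continuous (chart_at_is_chart x) (chart_at_dom x).
by move=> /cvgrPdist_lt/(_ d d0); apply: filterS => z; rewrite distrC.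
Qed.

Lemma cvg_chart (T : Type) (F : set_system T) (X : banach_manifold R) (x : X)
    (q : T -> X) :
  Filter F -> (forall d, 0 < d -> F (q @^-1` chart_ball x d)) -> q @ F --> x.
Proof.
move=> FF qF; set c := chart_at x.
have hc : is_chart c := chart_at_is_chart x.
have dx : cdom c x := chart_at_dom x.
have h1 : cmap c \o q @ F --> cmap c x.
  apply/cvgrPdist_lt => d d0; apply: filterS (qF d d0) => n [_].
  by rewrite distrC.
have xi : cimage c (cmap c x) by exists x.
have h2 : cinv c \o (cmap c \o q) @ F --> x.
  have := cinv_continuous hc xi; rewrite /prop_for /continuous_at (cmapK hc)//.
  by move=> ci; apply: cvg_comp h1 ci.
move=> P /h2 FP; have FP' : F (fun n => P (cinv c (cmap c (q n)))) := FP.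
change (F (q @^-1` P)).
apply: filterS (filterI (qF 1 ltr01) FP') => n [[qd _]].
by rewrite (cmapK hc).
Qed.

(** Common source of the estimates for the product of G and for the action; the maximum is the norm
    of the product model space. *)
Lemma smooth_map_strict (X Y Z : banach_manifold R) (f : X * Y -> Z)
    (x : X) (y : Y) (z : Z) :
  let cx := chart_at x in let cy := chart_at y in let cz := chart_at z in
  smooth_map (prod_atlas (atlas X) (atlas Y)) (atlas Z) f ->
  f (x, y) = z ->
  let rep := cmap cz \o f \o cinv (prod_chart cx cy) in
  let p0 : (cmodel cx * cmodel cy)%type := (cmap cx x, cmap cy y) in
  differentiable rep p0 /\
  forall e : R, 0 < e -> exists2 d : R, 0 < d &
    (forall g h, chart_ball x d g -> chart_ball y d h -> cdom cz (f (g, h))) /\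
    (forall g g' h h', chart_ball x d g -> chart_ball x d g' ->
       chart_ball y d h -> chart_ball y d h' ->
       `|cmap cz (f (g', h')) - cmap cz (f (g, h)) -
         'd rep p0 (cmap cx g' - cmap cx g, cmap cy h' - cmap cy h)| <=
       e * Num.max `|cmap cx g' - cmap cx g| `|cmap cy h' - cmap cy h|).
Proof.
move=> cx cy cz [fc fs] fz rep p0.
have hx : is_chart cx := chart_at_is_chart x.
have hy : is_chart cy := chart_at_is_chart y.
have hz : is_chart cz := chart_at_is_chart z.
have hp := prod_is_chart hx hy.
have dp : cdom (prod_chart cx cy) (x, y) by split; exact: chart_at_dom.
have dz : cdom cz (f (x, y)) by rewrite fz; exact: chart_at_dom.
have sm := fs (index_at x, index_at y) (index_at z).
pose pc := prod_chart cx cy.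
pose U := cmap pc @` (cdom pc `&` f @^-1` cdom cz).
have Up0 : nbhs p0 U := local_rep_nbhs hp hz (fc (x, y)) dp dz.
split.
  have [dr _] := sm 1%N; apply: dr; exact: (nbhs_singleton Up0).
move=> e e0.
have [d1 d10 d1P] := strict_differentiable Up0 sm e0.
have [d2 d20 d2P] := near_normP Up0.
have inb g h r : chart_ball x r g -> chart_ball y r h ->
    `|(cmap cx g, cmap cy h) - p0| < r.
  by move=> [_ gr] [_ hr]; rewrite prod_normE /= gt_max gr hr.
have repE g h : cdom cx g -> cdom cy h ->
    rep (cmap cx g, cmap cy h) = cmap cz (f (g, h)).
  by move=> dg dh; rewrite /rep /= (cmapK hx)// (cmapK hy).
exists (Num.min d1 d2); first by rewrite lt_min d10 d20.
have m1 : Num.min d1 d2 <= d1 by rewrite ge_min lexx.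
have m2 : Num.min d1 d2 <= d2 by rewrite ge_min lexx orbT.
split => [g h gb hb|g g' h h' gb gb' hb hb'].
  have [[g0 h0] [/= [dg0 dh0] fd] [g0E h0E]] :=
    d2P _ (inb _ _ _ (chart_ball_sub m2 gb) (chart_ball_sub m2 hb)).
  rewrite -(cmapK hx gb.1) -(cmapK hy hb.1) -g0E -h0E.
  by rewrite (cmapK hx dg0) (cmapK hy dh0).
have := d1P _ _ (inb _ _ _ (chart_ball_sub m1 gb) (chart_ball_sub m1 hb))
  (inb _ _ _ (chart_ball_sub m1 gb') (chart_ball_sub m1 hb')).
rewrite -/rep (repE _ _ gb.1 hb.1) (repE _ _ gb'.1 hb'.1).
by rewrite prod_normE.
Qed.

End ChartBall.

(** * Local estimates for products, powers and the action *)

Section Action.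
Context {R : realType} (G : banach_lie_group R) (M : banach_manifold R).
Variables (Phi : G -> M -> M) (x : M).
Hypothesis hPhi : is_smooth_action Phi.

Local Notation "g ** h" := (@lie_mul R G g h) (at level 40).
Local Notation e := (lie_one G).
Local Notation phi := (cmap (chart_at e)).
Local Notation psi := (cmap (chart_at x)).

(* The differential of the product at (e, e) is eliminated by comparing the     *)
(* pairs (g, e), (g, h) with (e, e), (e, h).                                    *)
Lemma lie_mul_chart (eta : R) : 0 < eta -> exists2 d : R, 0 < d &
  forall g h, chart_ball e d g -> chart_ball e d h ->
    cdom (chart_at e) (g ** h) /\
    `|phi (g ** h) - phi g - (phi h - phi e)| <= eta * `|phi h - phi e|.
Proof.
move=> eta0; have eta20 : 0 < eta / 2 by rewrite divr_gt0.
have [_ /(_ _ eta20)[d d0 [dP1 dP2]]] :=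
  smooth_map_strict (lie_mul_smooth G) (lie_mul1 e : _ (e, e) = e).
exists d => // g h gd hd; split; first exact: (dP1 g h).
have ed : chart_ball e d e by exact: chart_ballxx.
have := dP2 g g e h gd gd ed hd; have := dP2 e e e h ed ed ed hd.
move: ('d _ _) => D /=.
rewrite !subrr !normr0 !lie_mulr1 !lie_mul1 !max_r//.
move: (D _) => z h1 h2.
have -> : phi (g ** h) - phi g - (phi h - phi e) =
  (phi (g ** h) - phi g - z) - (phi h - phi e - z).
  by rewrite [- (_ - _ - z)]opprB [RHS]addrA subrK.
by apply: le_trans (ler_normB _ _) _; lra.
Qed.

(** Strict differentiability with error 1, plus a bound k on the differential, gives L = k + 1.
    Comparing (g, x) with (g, y) cancels the variation in g, so L is uniform in g near e. *)
Lemma action_chart_lipschitz : exists2 L : R, 0 < L & exists2 d : R, 0 < d &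
  forall g y, chart_ball e d g -> chart_ball x d y ->
    cdom (chart_at x) (Phi g y) /\
    `|psi (Phi g y) - psi (Phi g x)| <= L * `|psi y - psi x|.
Proof.
have [dD /(_ 1 ltr01)[d d0 [dP1 dP2]]] :=
  smooth_map_strict (action_smooth hPhi) (action_one hPhi x : _ (e, x) = x).
have [k k0 kP] := linear_lipschitz (diff_continuous dD).
exists (k + 1); first by rewrite addr_gt0.
exists d => // g y gd yd; split; first exact: (dP1 g y).
have xd : chart_ball x d x by exact: chart_ballxx.
have := dP2 g g x y gd gd xd yd => /=.
rewrite subrr normr0 max_r//; set z := 'd _ _ _ => hz.
have := kP (phi g - phi g, psi y - psi x).
rewrite prod_normE /= subrr normr0 max_r// => zle.
rewrite -[X in `|X|](subrK z).
by apply: le_trans (ler_normD _ _) _; lra.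
Qed.

Lemma orbit_differentiable :
  differentiable (psi \o orbit_map Phi x \o cinv (chart_at e)) (phi e).
Proof.
have [dD _] :=
  smooth_map_strict (action_smooth hPhi) (action_one hPhi x : _ (e, x) = x).
set rep := (X in differentiable X _) in dD.
have -> : psi \o orbit_map Phi x \o cinv (chart_at e) =
    rep \o (fun u => (u, psi x)).
  apply/funext => u; rewrite /rep /orbit_map /=.
  by rewrite (cmapK (chart_at_is_chart x))//; exact: chart_at_dom.
apply: differentiable_comp => //.
Qed.

(** Multiplying on the right makes the step from h^j x to h^(j+1) x the image under h^j of the step
    from x to h x. *)
Definition lie_pow (h : G) (n : nat) : G := iter n (fun g => g ** h) e.

(** The errors of the successive products add up. Since eta <= 1, the estimate keeps h^j within 2k
    |phi h - phi e| < d of e, which is what allows the next product to be estimated. *)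
Lemma lie_pow_chart (eta d : R) :
  0 < eta <= 1 ->
  (forall g h, chart_ball e d g -> chart_ball e d h ->
    cdom (chart_at e) (g ** h) /\
    `|phi (g ** h) - phi g - (phi h - phi e)| <= eta * `|phi h - phi e|) ->
  forall (h : G) (k : nat), chart_ball e d h ->
    k%:R * (2 * `|phi h - phi e|) < d ->
  forall j, (j <= k)%N -> chart_ball e d (lie_pow h j) /\
    `|phi (lie_pow h j) - phi e - j%:R *: (phi h - phi e)| <=
      j%:R * (eta * `|phi h - phi e|).
Proof.
move=> /andP[eta0 eta1] dP h k hd hk.
have w0 := normr_ge0 (phi h - phi e).
have d0 : 0 < d by apply: le_lt_trans hk; rewrite !mulr_ge0.
elim=> [|j IH] jk.
  rewrite /lie_pow /=; split; first exact: chart_ballxx.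
  by rewrite subrr scale0r subr0 normr0 mul0r.
have [pd pj] := IH (ltnW jk); have [dom step] := dP _ _ pd hd.
have est : `|phi (lie_pow h j.+1) - phi e - j.+1%:R *: (phi h - phi e)| <=
      j.+1%:R * (eta * `|phi h - phi e|).
  have -> : phi (lie_pow h j.+1) - phi e - j.+1%:R *: (phi h - phi e) =
    (phi (lie_pow h j ** h) - phi (lie_pow h j) - (phi h - phi e)) +
    (phi (lie_pow h j) - phi e - j%:R *: (phi h - phi e)).
    rewrite /lie_pow iterS -/(lie_pow h j) -natr1 scalerDl scale1r.
    by rewrite [- (_ *: _ + _)]opprD addrA [RHS]addrAC
      [_ + (_ - _ *: _)]addrA subrKA.
  rewrite -natr1 mulrDl mul1r addrC [leRHS]addrC.
  by apply: le_trans (ler_normD _ _) _; rewrite addrC lerD.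
split => //; split => //.
rewrite -[X in `|X|](subrK (j.+1%:R *: (phi h - phi e))).
apply: le_lt_trans (ler_normD _ _) _; rewrite normrZ normr_nat.
apply: le_lt_trans hk.
have jk' : (j.+1%:R : R) <= k%:R by rewrite ler_nat.
have j0 : 0 <= (j.+1%:R : R) by [].
apply: le_trans (ler_wpM2r _ jk'); last by rewrite mulr_ge0.
apply: le_trans (lerD est (lexx _)) _.
rewrite -mulrDr ler_wpM2l//.
nra.
Qed.

(* The step from h^j x to h^j (h x) is at most L times the step from x to h x.  *)
Lemma lie_pow_action (L d : R) :
  0 < d ->
  (forall g y, chart_ball e d g -> chart_ball x d y ->
    cdom (chart_at x) (Phi g y) /\
    `|psi (Phi g y) - psi (Phi g x)| <= L * `|psi y - psi x|) ->
  forall (h : G) (k : nat), (forall j, (j <= k)%N -> chart_ball e d (lie_pow h j)) ->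
    chart_ball x d (Phi h x) ->
  forall j, (j <= k)%N -> cdom (chart_at x) (Phi (lie_pow h j) x) /\
    `|psi (Phi (lie_pow h j) x) - psi x| <=
      j%:R * (L * `|psi (Phi h x) - psi x|).
Proof.
move=> d0 dP h k hk hx; elim=> [|j IH] jk.
  rewrite /lie_pow /= (action_one hPhi) subrr normr0 mul0r.
  by split=> //; exact: chart_at_dom.
have [_ est] := IH (ltnW jk); have [dom step] := dP _ _ (hk j (ltnW jk)) hx.
rewrite /lie_pow iterS -/(lie_pow h j) (action_mul hPhi); split => //.
rewrite -natr1 -(subrKA (psi (Phi (lie_pow h j) x))).
by apply: le_trans (ler_normD _ _) _; lra.
Qed.

End Action.

(** * Consequences of properness *)

Section Proper.
Context {R : realType} (G : banach_lie_group R) (M : banach_manifold R).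
Variables (Phi : G -> M -> M) (x : M).
Hypothesis hPhi : is_smooth_action Phi.
Hypothesis hproper : is_proper_action Phi.

Local Notation "g ** h" := (@lie_mul R G g h) (at level 40).
Local Notation e := (lie_one G).
Local Notation phi := (cmap (chart_at e)).
Local Notation psi := (cmap (chart_at x)).

Lemma lie_divl_continuous :
  continuous (fun p : G * G => lie_inv p.1 ** p.2).
Proof.
move=> p.
have h : {for p, continuous (fun p : G * G => (lie_inv p.1, p.2))}.
  apply: (@continuous_prod_map _ _ _ _ (@lie_inv R G) id).
    exact: (lie_inv_smooth G).1.
  exact: cvg_id.
have := (lie_mul_smooth G).1 (lie_inv p.1, p.2).
by move: h; apply: cvg_comp.
Qed.

(** The points (q n, x) have images (q n x, x) tending to (x, x) under the proper map, so they
    converge along U. *)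
Lemma orbit_return_cvg (T : Type) (U : set_system T) (q : T -> G) :
  UltraFilter U ->
  (forall r, 0 < r -> U [set n | chart_ball x r (Phi (q n) x)]) ->
  exists g : G, q @ U --> g.
Proof.
move=> UU qU; pose f (p : G * M) := (Phi p.1 p.2, p.2).
have h : f \o (fun n => (q n, x)) @ U --> (x, x).
  have h1 : (fun n => Phi (q n) x) @ U --> x by exact: cvg_chart.
  have h2 : (fun _ : T => x) @ U --> x by exact: cvg_cst.
  exact: cvg_pair h1 h2.
have [[g y] _ qg] := proper_ultra_cvg hproper UU h.
exists g => V gV; have : nbhs (g, y) (fst @^-1` V).
  by exists (V, setT); [split => //; exact: filterT|move=> p []].
by move=> /qg.
Qed.

Lemma orbit_tangent_compact (u : nat -> lie_algebra G) (U : set_system nat) :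
  UltraFilter U -> \oo `<=` U -> (forall n, `|u n| = 1) ->
  orbit_tangent Phi x \o u @ \oo --> (0 : tangent_space x) ->
  cvg (u @ U).
Proof.
move=> UU oU u1 Au0; apply: cauchy_cvg; apply: cauchy_exP => eps eps0.
(* The final estimate is 3 eta < eps; the bound by 1 is needed for the powers. *)
pose eta : R := Num.min 1 (eps / 4).
have eta0 : 0 < eta by rewrite lt_min ltr01 divr_gt0.
have eta1 : eta <= 1 by rewrite ge_min lexx.
have eta_eps : eta <= eps / 4 by rewrite ge_min lexx orbT.
have [d1 d10 d1P] := lie_mul_chart G eta0.
have [L L0 [d2 d20 d2P]] := action_chart_lipschitz x hPhi.
have hc : is_chart (chart_at e) := chart_at_is_chart e.
have [d3 d30 d3P] : exists2 d : R, 0 < d & forall v, `|v - phi e| < d ->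
    cimage (chart_at e) v.
  apply: near_normP; apply: open_nbhs_nbhs; split; first exact: cimage_open.
  by exists e => //; exact: chart_at_dom.
pose d := Num.min d1 (Num.min d2 d3).
have d0 : 0 < d by rewrite !lt_min d10 d20 d30.
have dd1 : d <= d1 by rewrite ge_min lexx.
have dd2 : d <= d2 by rewrite !ge_min lexx orbT.
have dd3 : d <= d3 by rewrite !ge_min lexx !orbT.
(* The total path length is (n+1) |w n| = tau, and [lie_pow_chart] requires 2 tau < d. *)
pose tau : R := d / 4.
have tau0 : 0 < tau by rewrite divr_gt0.
pose w n : lie_algebra G := (tau / n.+1%:R) *: u n.
have nw n : `|w n| = tau / n.+1%:R.
  by rewrite normrZ u1 mulr1 gtr0_norm// divr_gt0.
have wle n : `|w n| <= tau.
  by rewrite nw ler_pdivrMr// ler_peMr ?(ltW tau0)// ler1n.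
pose h n := cinv (chart_at e) (phi e + w n).
have [hdom phih] : (forall n, cdom (chart_at e) (h n)) /\
    (forall n, phi (h n) = phi e + w n).
  apply/all_and2 => n.
  have [|g gd gE] := d3P (phi e + w n).
    by rewrite addrAC subrr add0r; have := wle n; rewrite /tau; lra.
  by rewrite /h -gE (cmapK hc gd).
have phihB n : phi (h n) - phi e = w n by rewrite phih addrAC subrr add0r.
have hd n : chart_ball e d (h n).
  by split => //; rewrite phihB; have := wle n; rewrite /tau; lra.
have nwn n : n.+1%:R * `|w n| = tau by rewrite nw mulrC divfK.
pose q n := lie_pow (h n) n.+1.
have powP n j : (j <= n.+1)%N -> chart_ball e d (lie_pow (h n) j) /\
    `|phi (lie_pow (h n) j) - phi e - j%:R *: w n| <= j%:R * (eta * `|w n|).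
  move=> jn; rewrite -phihB.
  apply: (@lie_pow_chart _ _ _ _ _ _ (h n) n.+1) => //; first by rewrite eta0.
    move=> g g' gd gd'.
    by apply: d1P; [exact: chart_ball_sub gd|exact: chart_ball_sub gd'].
  by rewrite phihB mulrCA nwn /tau; lra.
have qest n : `|phi (q n) - phi e - tau *: u n| <= eta * tau.
  have [_] := powP n n.+1 (leqnn _); rewrite mulrCA nwn.
  by rewrite /w scalerA [_ * (tau / _)]mulrC divfK.
have hx n : cdom (chart_at x) (Phi (h n) x).
  have [] // := d2P (h n) x; first exact: chart_ball_sub (hd n).
  exact: chart_ballxx.
have qx r : 0 < r -> \forall n \near \oo, chart_ball x r (Phi (q n) x).
  (* The n+1 steps move x by at most (n+1) L |w n| (|A u_n| + s) = L tau (|A u_n| + s), which is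
     below 2 L tau s = r once |A u_n| < s. *)
  move=> r0; pose s : R := r / (2 * (L * tau)).
  have s0 : 0 < s by rewrite divr_gt0// !mulr_gt0.
  pose f := psi \o orbit_map Phi x \o cinv (chart_at e).
  have df : differentiable f (phi e) := orbit_differentiable x hPhi.
  have fe : f (phi e) = psi x.
    by rewrite /f /orbit_map /= (cmapK hc (chart_at_dom e)) (action_one hPhi).
  have [d4 d40 d4P] := near_normP (differentiable_le df s0).
  have wsmall r' : 0 < r' -> \forall n \near \oo, `|w n| < r'.
    move=> r'0; have := @cvg_harmonic R.
    move=> /cvgrPdist_lt/(_ (r' / tau) (divr_gt0 r'0 tau0)).
    apply: filterS => n; rewrite sub0r normrN /= ger0_norm ?invr_ge0//.
    by rewrite nw ltr_pdivlMr// mulrC.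
  have Aus : \forall n \near \oo, `|orbit_tangent Phi x (u n)| < s.
    by move: Au0 => /cvgrPdist_lt/(_ s s0); apply: filterS => n /=; rewrite sub0r normrN.
  have hxle : \forall n \near \oo,
      n.+1%:R * (L * `|psi (Phi (h n) x) - psi x|) < r.
    apply: filterS2 (wsmall _ d40) Aus => n wn An.
    have := d4P (phi e + w n); rewrite addrAC subrr add0r => /(_ wn).
    rewrite fe => est.
    have Aw : `|'d f (phi e) (w n)| = `|w n| * `|orbit_tangent Phi x (u n)|.
      rewrite /w linearZ /= !normrZ u1 mulr1; congr (_ * _).
    have hle : `|psi (Phi (h n) x) - psi x| <=
        `|w n| * (`|orbit_tangent Phi x (u n)| + s).
      rewrite -[X in `|X|](subrK ('d f (phi e) (w n))).
      apply: le_trans (ler_normD _ _) _; rewrite Aw mulrDr addrC lerD2l.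
      by rewrite mulrC.
    apply: le_lt_trans (ler_wpM2l _ (ler_wpM2l (ltW L0) hle)) _ => //.
    rewrite mulrCA [n.+1%:R * _]mulrA nwn mulrA -ltr_pdivlMl ?mulr_gt0//.
    have -> : (L * tau)^-1 * r = s + s.
      by rewrite /s; field; rewrite !gt_eqF.
    lra.
  have hxd : \forall n \near \oo, chart_ball x d2 (Phi (h n) x).
    have := differentiable_continuous df.
    move=> /cvgrPdist_lt/(_ d2 d20)/near_normP[d5 d50 d5P].
    apply: filterS (wsmall _ d50) => n wn; split; first exact: hx.
    have := d5P (phi e + w n); rewrite addrAC subrr add0r => /(_ wn).
    by rewrite fe distrC.
  apply: filterS2 hxle hxd => n qn hxn.
  have powd j : (j <= n.+1)%N -> chart_ball e d2 (lie_pow (h n) j).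
    by move=> jn; apply: chart_ball_sub (powP n j jn).1.
  have [qdom qle] := lie_pow_action hPhi d20 d2P powd hxn (leqnn _).
  by split => //; exact: le_lt_trans qn.
have [g qg] : exists g : G, q @ U --> g.
  apply: orbit_return_cvg => r r0; exact: oU (qx r r0).
(* Multiplying by an element of the d'-ball moves coordinates by at most (1 + eta) d' <= 2 d' <= eta
   tau. *)
pose d' := Num.min d (eta * tau / 2).
have d'0 : 0 < d' by rewrite lt_min d0 divr_gt0// mulr_gt0.
have d'd : d' <= d by rewrite ge_min lexx.
have d'eta : d' <= eta * tau / 2 by rewrite ge_min lexx orbT.
(* The map (a, b) -> a^-1 b takes (g, g) to e, so the q_n are compared in the chart at e and no
   chart at g is used. *)
have [[V1 V2] [/= gV1 gV2] V12] :
    nbhs (g, g) (fun p : G * G => chart_ball e d' (lie_inv p.1 ** p.2)).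
  have ge : nbhs (lie_inv (g, g).1 ** (g, g).2) (chart_ball e d').
    by rewrite /= lie_mulV; exact: nbhs_chart_ball.
  exact: (lie_divl_continuous ge).
have UV : U (q @^-1` (V1 `&` V2)) .
  by apply: filterI; exact: qg.
have [N [N1 N2]] := filter_ex UV.
exists (u N); apply: filterS UV => n [_ n2].
have wb : chart_ball e d' (lie_inv (q N) ** q n) by apply: (V12 (q N, q n)).
have [_] := d1P (q N) _ (chart_ball_sub dd1 (powP N N.+1 (leqnn _)).1)
  (chart_ball_sub (le_trans d'd dd1) wb).
rewrite lie_mulKr => close.
have qq : `|phi (q n) - phi (q N)| <= eta * tau.
  move: close wb.2; set v := phi _ - phi e => close vd.
  rewrite -[X in `|X|](subrK v); apply: le_trans (ler_normD _ _) _.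
  have := normr_ge0 v; nra.
(* One eta tau for each of q_n and q_N as approximations of tau u_n and tau u_N, and one for their
   mutual distance. *)
have : `|tau *: (u N - u n)| <= 3 * eta * tau.
  have -> : tau *: (u N - u n) = (phi (q n) - phi e - tau *: u n)
      - (phi (q N) - phi e - tau *: u N) - (phi (q n) - phi (q N)).
    rewrite scalerBr; move: (phi (q n)) (phi (q N)) (phi e) => a b c.
    apply/eqP; rewrite eq_sym subr_eq [- (b - c - _)]opprB addrCA.
    by rewrite [a - c - _ - _]addrAC [- (b - c)]opprB subrKA addrA addrAC.
  apply: le_trans (ler_normB _ _) _.
  have := ler_normB (phi (q n) - phi e - tau *: u n) (phi (q N) - phi e - tau *: u N).
  have := qest n; have := qest N; lra.
rewrite normrZ gtr0_norm// mulrC ler_pM2r// => un.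
rewrite -ball_normE /=.
by apply: le_lt_trans un _; lra.
Qed.

End Proper.

(** * The tangent map of the orbit map and fundamental fields *)

Section Exp.
Context {R : realType} (G : banach_lie_group R) (M : banach_manifold R).
Variables (Phi : G -> M -> M) (x : M).
Hypothesis hPhi : is_smooth_action Phi.
Local Notation e := (lie_one G).
Local Notation phi := (cmap (chart_at e)).
Local Notation psi := (cmap (chart_at x)).

Lemma one_parameter_subgroup0 (c : R -> G) :
  is_one_parameter_subgroup c -> c 0 = e.
Proof.
move=> [_ cD]; apply: (@lie_mulI _ G (c 0)).
by rewrite -cD addr0 lie_mulr1.
Qed.

Lemma velocity_orbit (c : R -> G) :
  is_one_parameter_subgroup c ->
  velocity (fun t => Phi (c t) x) x = orbit_tangent Phi x (velocity c e).
Proof.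
move=> cP; have c0 := one_parameter_subgroup0 cP.
have [[cc cs] _] := cP.
have dc : differentiable (phi \o c) (0 : R).
  have [+ _] := cs tt (index_at e) 1%N; apply.
  by exists 0 => //; split => //=; rewrite c0; exact: chart_at_dom.
have hc : is_chart (chart_at e) := chart_at_is_chart e.
have df := orbit_differentiable x hPhi.
pose f := psi \o orbit_map Phi x \o cinv (chart_at e).
rewrite -/f in df.
have dfc : differentiable f ((phi \o c) 0) by rewrite /= c0.
rewrite /velocity !derive1E.
(* The two curves agree only while c t stays in the chart at e, which is enough for a derivative at
   0. *)
have -> : 'D_1 (psi \o (fun t => Phi (c t) x)) 0 = 'D_1 (f \o (phi \o c)) 0.
  apply: near_eq_derive.
  have : \forall t \near (0 : R), cdom (chart_at e) (c t).
    apply: cc; rewrite c0; apply: open_nbhs_nbhs; split; last exact: chart_at_dom.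
    exact: cdom_open.
  by apply: filterS => t ct; rewrite /f /orbit_map /= (cmapK hc).
rewrite (deriveE _ (differentiable_comp dc dfc)) (deriveE _ dc) diff_comp//=.
by rewrite c0.
Qed.

End Exp.

Theorem theorem2p1 (R : realType) (G : banach_lie_group R)
    (M : banach_manifold R) (Phi : G -> M -> M)
    (hPhi : is_smooth_action Phi) (hproper : is_proper_action Phi) (x : M) :
  [/\ continuous (orbit_tangent Phi x),
      forall expG : lie_algebra G -> G, is_exponential_map expG ->
        forall xi, orbit_tangent Phi x xi = fundamental_field expG Phi xi x
    & closed (range (orbit_tangent Phi x))].
Proof.
have cA : continuous (orbit_tangent Phi x).
  exact: diff_continuous (orbit_differentiable x hPhi).
split=> // [expG expP xi|].
  by have [cP vP] := expP xi; rewrite /fundamental_field velocity_orbit// vP.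
have [C CP] := bounded_section_of_compact cA
  (fun u U => @orbit_tangent_compact _ _ _ _ _ hPhi hproper u U).
exact: closed_range_of_bounded_section cA CP.
Qed.
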